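(* Let $\alpha\in\mathbb{R}$ with $\alpha\neq 0$, let $a<b$ be real numbers, and let $\{x_j\}_{j\in\mathbb{Z}}$ be a scattered sequence of real numbers. For every $\epsilon>0$ and every continuous function $f:[a,b]\to\mathbb{R}$, there exist $N\geq 1$ and real coefficients $\{a_j\}_{j=1}^{N}$ such that $$\sup_{x\in[a,b]}\left|f(x)-\sum_{j=1}^{N}\frac{a_j}{\alpha^2+(x-x_j)^2}\right|<\epsilon.$$
   Context: A sequence $\mathcal{X}$ of real numbers is $\delta$-separated if $\inf_{x,y\in\mathcal{X},\,x\neq y}|x-y|=\delta>0$. A sequence $\{x_j\}_{j\in\mathbb{Z}}\subset\mathbb{R}$ is scattered if it is $\delta$-separated for some $\delta>0$ and $\lim_{j\to+\infty}x_j=+\infty$ and $\lim_{j\to-\infty}x_j=-\infty$. *)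

(* Defs.v *)
From mathcomp Require Import all_boot all_order all_algebra.
From mathcomp Require Import all_classical all_reals all_analysis.

Set Implicit Arguments.
Unset Strict Implicit.
Unset Printing Implicit Defensive.

Import Order.TTheory GRing.Theory Num.Theory.
Import numFieldNormedType.Exports.

Local Open Scope classical_set_scope.
Local Open Scope ring_scope.

(* The pairs range over distinct values, so a sequence with repeated values may
   have a separated range. *)
Definition separated (R : realType) (delta : R) (X : set R) : Prop :=
  0 < delta /\
  ereal_inf [set (`|p.1 - p.2|)%:E |
             p in [set p : R * R | [/\ X p.1, X p.2 & p.1 <> p.2]]]
  = delta%:E.

(* The limits at the two ends of [int] are expressed along the sequences
   [j = n] and [j = - n] for [n : nat]. *)
Definition scattered (R : realType) (x : int -> R) : Prop :=
  [/\ exists delta : R, separated delta (range x),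
      x n%:Z @[n --> \oo] --> +oo
    & x (- n%:Z) @[n --> \oo] --> -oo].

(* Main.v *)
Require Import Defs.
From mathcomp Require Import all_boot all_order all_algebra.
From mathcomp Require Import all_classical all_reals all_analysis.
From mathcomp Require Import ring lra.

(** The kernels [1 / (alpha ^ 2 + (t - x_j) ^ 2)] are values at [s = 1 / x_j] of
    a function that is analytic in [s] near [0]:
[[
      1 / (alpha ^ 2 + (t - 1 / s) ^ 2) = s ^ 2 / q(t, s),
      q(t, s) = (1 - t s) ^ 2 + alpha ^ 2 s ^ 2,
      1 / q(t, s) = p_0(t) + p_1(t) s + p_2(t) s ^ 2 + ...
]]
    Here [p_n] is a polynomial of degree [n] with leading coefficient [n + 1]
    ([kernel_poly], [coef_kernel_poly]).  Since [x_j] tends to infinity, the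
    points [1 / x_j] accumulate at [0], and that is enough to recover every
    coefficient [p_n] from the kernels.  Indeed, by [kernel_remainder_bound],
[[
      s ^ (- n) (1 / q(t, s) - sum_(k < n) p_k(t) s ^ k) = p_n(t) + O(s)
]]
    uniformly for [t] in a bounded interval.  If [p_0, ..., p_(n-1)] are uniform
    limits of linear combinations of kernels, then so is the left side for
    [s = 1 / x_j], and hence so is [p_n] ([approximable_kernel_poly]).

    The polynomials [p_n] span all polynomials ([approximable_poly]), and these
    are dense among the continuous functions on a segment
    ([weierstrass_approximation]). *)

Set Implicit Arguments.
Unset Strict Implicit.
Unset Printing Implicit Defensive.

Import Order.TTheory GRing.Theory Num.Theory.
Import numFieldNormedType.Exports.

Local Open Scope classical_set_scope.
Local Open Scope ring_scope.

(** * Weierstrass approximation by Bernstein polynomials *)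

(** The Bernstein polynomial of degree [n] with coefficients [g 0, ..., g n]:
    at [u] it is the expectation of [g] at the number of successes in [n] independent
    trials of probability [u].  The recursion conditions on one trial, so that
    each property below is an induction without binomial coefficients. *)
Fixpoint bernstein (R : comNzRingType) (n : nat) (g : nat -> R) : {poly R} :=
  if n is m.+1 then (1 - 'X) * bernstein m g + 'X * bernstein m (g \o S)
  else (g 0)%:P.

Lemma hornerBernsteinS (R : comNzRingType) n (g : nat -> R) (u : R) :
  (bernstein n.+1 g).[u] =
  (1 - u) * (bernstein n g).[u] + u * (bernstein n (g \o S)).[u].
Proof. by rewrite /= !hornerE. Qed.

Lemma le_bernstein (R : numDomainType) n (g h : nat -> R) (u : R) :
  0 <= u <= 1 -> (forall k, (k <= n)%N -> g k <= h k) ->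
  (bernstein n g).[u] <= (bernstein n h).[u].
Proof.
move=> /andP[u0 u1]; elim: n g h => [|n IHn] g h le_gh.
  by rewrite /= !hornerC le_gh.
rewrite !hornerBernsteinS lerD// ler_wpM2l ?subr_ge0//; apply: IHn => k lekn.
  by rewrite le_gh// ltnW.
exact: le_gh.
Qed.

(** The mean and the variance of the binomial law, in one formula: the second
    moment about [c] is [n u (1 - u) + (n u - c) ^ 2].  Leaving [c] free makes
    the induction go through, since one more success replaces [c] by [c - 1]. *)
Lemma bernstein_quadratic (R : comNzRingType) n (e m c u : R) :
  (bernstein n (fun k => e + m * (k%:R - c) ^+ 2)).[u] =
  e + m * (n%:R * u * (1 - u) + (n%:R * u - c) ^+ 2).
Proof.
elim: n c => [|n IHn] c; first by rewrite /= hornerC; ring.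
rewrite hornerBernsteinS.
have -> : (fun k => e + m * (k%:R - c) ^+ 2) \o S =
          (fun k => e + m * (k%:R - (c - 1)) ^+ 2).
  by apply/funext => k /=; ring.
by rewrite !IHn; ring.
Qed.

(** Uniform continuity in the form that a variance estimate consumes: nearby
    points are covered by [eps], and for distant ones the quadratic term
    exceeds the oscillation of [f].  Compactness is applied with the constant
    [C] tending to infinity as the parameter that has to be uniform. *)
Lemma quadratic_modulus (R : realType) (a b : R) (f : R -> R) (eps : R) :
  a <= b -> {within `[a, b], continuous f} -> 0 < eps ->
  exists2 C : R, 0 <= C & forall s t, s \in `[a, b] -> t \in `[a, b] ->
    `|f s - f t| <= eps + C * (s - t) ^+ 2.
Proof.
move=> leab cf eps0.
have [cM cMab fM] := EVT_max leab cf.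
have [cm cmab fm] := EVT_min leab cf.
pose M := f cM - f cm.
have M0 : 0 <= M by rewrite subr_ge0 fM.
have boundM s t : s \in `[a, b] -> t \in `[a, b] -> `|f s - f t| <= M.
  move=> sab tab; rewrite ler_norml.
  have := fM _ sab; have := fM _ tab; have := fm _ sab; have := fm _ tab.
  by rewrite /M => ? ? ? ?; apply/andP; split; lra.
have : \forall C \near +oo, `[a, b]%classic `<=` [set s | s \in `[a, b] ->
    forall t, t \in `[a, b] -> `|f s - f t| <= eps + C * (s - t) ^+ 2].
  apply: (@compact_near_coveringP R `[a, b]%classic).1
    (@segment_compact R a b) _ _ _ _ _.
  move=> z zab.
  have /subspace_continuousP/(_ z zab)/cvgrPdist_lt/(_ (eps / 2)) := cf.
  rewrite divr_gt0// => /(_ isT).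
  move=> /nbhs_ballP[d /= d0 fd0].
  have fd u : `|z - u| < d -> u \in `[a, b] -> `|f z - f u| < eps / 2.
    exact: fd0.
  have d2 : 0 < d / 2 by rewrite divr_gt0.
  exists (ball z (d / 2), [set C | M / (d / 2) ^+ 2 <= C]) => /=.
    by split; [exact: nbhsx_ballx | exact/nbhs_pinfty_ge/num_real].
  move=> [s C] /= [zs MC] sab t tab.
  have {zs} zs : `|z - s| < d / 2 by [].
  have C0 : 0 <= C by apply: le_trans MC; rewrite divr_ge0// sqr_ge0.
  have [st|st] := ltP `|s - t| (d / 2).
    have zs' : `|z - s| < d by lra.
    have zt : `|z - t| < d.
      by have := ler_normD (z - s) (s - t); rewrite addrA subrK; lra.
    have := fd s zs' sab; have := fd t zt tab.
    rewrite !ltr_norml => /andP[? ?] /andP[? ?].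
    have ? : 0 <= C * (s - t) ^+ 2 by rewrite mulr_ge0// sqr_ge0.
    by rewrite ler_norml; apply/andP; split; lra.
  rewrite (le_trans (boundM _ _ sab tab))// (ler_wpDl (ltW eps0))//.
  move: MC; rewrite ler_pdivrMr ?exprn_gt0// => MC.
  rewrite (le_trans MC)// ler_wpM2l// -(real_normK (num_real (s - t))).
  by rewrite lerXn2r ?nnegrE ?(ltW d2).
move=> /(pinfty_ex_ge (num_real 0))[C C0 fC].
by exists C => // s t sab; exact: (fC s sab sab).
Qed.

(** The value of the Bernstein polynomial at [t] is an average of [f] over the
    nodes; by [quadratic_modulus] it differs from [f t] by at most [eps / 2]
    plus [C] times the variance of the nodes, which is [O(1 / n)]. *)
Theorem weierstrass_approximation (R : realType) (a b : R) (f : R -> R)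
    (eps : R) :
  a < b -> {within `[a, b], continuous f} -> 0 < eps ->
  exists p : {poly R}, forall t, t \in `[a, b] -> `|f t - p.[t]| <= eps.
Proof.
move=> ltab cf eps0.
have eps2 : 0 < eps / 2 by rewrite divr_gt0.
have [C C0 fC] := quadratic_modulus (ltW ltab) cf eps2.
have ba0 : 0 < b - a by rewrite subr_gt0.
have ratio_ge0 : 0 <= C * (b - a) ^+ 2 / (eps / 2).
  by rewrite divr_ge0 ?mulr_ge0 ?sqr_ge0// ltW.
have [n ltn] : exists n : nat, C * (b - a) ^+ 2 / (eps / 2) < n%:R.
  by eexists; exact: archi_boundP.
have n0 : 0 < n%:R :> R by exact: le_lt_trans ltn.
pose node (k : nat) : R := a + (b - a) * (k%:R / n%:R).
exists (bernstein n (f \o node) \Po (((b - a)^-1)%:P * ('X - a%:P))) => t tab.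
rewrite horner_comp !hornerE.
set u : R := (b - a)^-1 * (t - a).
have tE : t = a + (b - a) * u by rewrite /u; field; rewrite gt_eqF.
have /andP[ta tb] : a <= t <= b by rewrite in_itv in tab.
have u01 : 0 <= u <= 1.
  rewrite /u mulrC divr_ge0 ?subr_ge0 ?(ltW ltab)//=.
  by rewrite ler_pdivrMr// mul1r lerB.
pose m := C * ((b - a) / n%:R) ^+ 2.
have nodeE k : C * (node k - t) ^+ 2 = m * (k%:R - n%:R * u) ^+ 2.
  by rewrite /m /node {1}tE; field; rewrite gt_eqF.
have node_ab k : (k <= n)%N -> node k \in `[a, b].
  move=> lekn; rewrite in_itv /= /node lerDl -lerBrDl.
  rewrite mulr_ge0 ?divr_ge0 ?(ltW ba0)//=.
  by rewrite ler_piMr ?(ltW ba0)// ler_pdivrMr// mul1r ler_nat.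
have bound k : (k <= n)%N ->
    f t - eps / 2 - m * (k%:R - n%:R * u) ^+ 2 <= f (node k)
    <= f t + eps / 2 + m * (k%:R - n%:R * u) ^+ 2.
  move=> /node_ab kab; have := fC _ _ kab tab.
  by rewrite nodeE ler_norml => /andP[? ?]; apply/andP; split; lra.
have variance : m * (n%:R * u * (1 - u)) <= eps / 2.
  have -> : m * (n%:R * u * (1 - u)) =
            C * (b - a) ^+ 2 / n%:R * (u * (1 - u)).
    by rewrite /m; field; rewrite gt_eqF.
  apply: (@le_trans _ _ (C * (b - a) ^+ 2 / n%:R)).
    rewrite ler_piMr//; last by case/andP: u01 => ? ?; nra.
    by rewrite divr_ge0 ?mulr_ge0 ?sqr_ge0// ltW.
  by rewrite ler_pdivrMr// [eps / 2 * _]mulrC -ler_pdivrMr// ltW.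
have upper : (bernstein n (f \o node)).[u] <= f t + eps.
  apply: (@le_trans _ _ (bernstein n
    (fun k => (f t + eps / 2) + m * (k%:R - n%:R * u) ^+ 2)).[u]).
    by apply: le_bernstein => // k /bound/andP[].
  by rewrite bernstein_quadratic; lra.
have lower : f t - eps <= (bernstein n (f \o node)).[u].
  apply: (@le_trans _ _ (bernstein n
    (fun k => (f t - eps / 2) + (- m) * (k%:R - n%:R * u) ^+ 2)).[u]).
    by rewrite bernstein_quadratic; lra.
  by apply: le_bernstein => // k /bound/andP[]; rewrite mulNr.
by rewrite ler_norml; apply/andP; split; lra.
Qed.

(** * The uniform closure of the span of a sequence of functions *)

(** [g] lies in the closure, for uniform convergence on [D], of the span of
    [K 1, K 2, ...]; the index [0] is left out. *)
Definition approximable (R : realType) (D : set R) (K : nat -> R -> R)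
    (g : R -> R) : Prop :=
  forall eps, 0 < eps -> exists (N : nat) (c : nat -> R),
    forall t, D t -> `|g t - \sum_(1 <= j < N.+1) c j * K j t| <= eps.

Lemma widen_combination (R : realType) (K : nat -> R -> R) (N M : nat)
    (c : nat -> R) (t : R) : (N <= M)%N ->
  \sum_(1 <= j < N.+1) c j * K j t =
  \sum_(1 <= j < M.+1) (if (j < N.+1)%N then c j else 0) * K j t.
Proof.
move=> leNM; rewrite (big_nat_widen _ _ M.+1)// big_mkcond /=.
by apply: eq_bigr => j _; case: ifP; rewrite ?mul0r.
Qed.

Lemma approximable_linear (R : realType) (D : set R) (K : nat -> R -> R)
    (a : R) (g h : R -> R) :
  approximable D K g -> approximable D K h ->
  approximable D K (fun t => a * g t + h t).
Proof.
move=> apg aph eps eps0.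
have a1 : 0 < `|a| + 1 by rewrite ltr_wpDl.
have [N [c gc]] := apg (eps / 2 / (`|a| + 1)) ltac:(rewrite !divr_gt0//).
have [M [d hd]] := aph (eps / 2) ltac:(rewrite divr_gt0//).
pose c' j := if (j < N.+1)%N then c j else 0.
pose d' j := if (j < M.+1)%N then d j else 0.
exists (maxn N M), (fun j => a * c' j + d' j) => t Dt.
have -> : \sum_(1 <= j < (maxn N M).+1) (a * c' j + d' j) * K j t =
    a * (\sum_(1 <= j < N.+1) c j * K j t) + \sum_(1 <= j < M.+1) d j * K j t.
  rewrite (widen_combination K c t (leq_maxl N M)).
  rewrite (widen_combination K d t (leq_maxr N M)).
  rewrite big_distrr -big_split /=; apply: eq_bigr => j _.
  by rewrite /c' /d'; ring.
rewrite opprD addrACA -mulrBr (le_trans (ler_normD _ _))// (splitr eps).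
rewrite lerD ?hd// normrM.
apply: (@le_trans _ _ ((`|a| + 1) * (eps / 2 / (`|a| + 1)))).
  by rewrite ler_pM ?gc// lerDl.
by rewrite mulrC divfK// gt_eqF.
Qed.

Lemma approximable0 (R : realType) (D : set R) (K : nat -> R -> R) :
  approximable D K (fun=> 0).
Proof.
move=> eps eps0; exists 0%N, (fun=> 0) => t _.
by rewrite big_geq// subr0 normr0 ltW.
Qed.

Lemma approximable_generator (R : realType) (D : set R) (K : nat -> R -> R)
    (j : nat) : (0 < j)%N -> approximable D K (K j).
Proof.
move=> j0 eps eps0; exists j, (fun i => (i == j)%:R) => t _.
rewrite big_nat_recr//= eqxx mul1r big_nat big1 ?add0r ?subrr ?normr0 ?ltW//.
by move=> i /andP[_ ltij]; rewrite ltn_eqF// mul0r.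
Qed.

Lemma approximable_sum (R : realType) (D : set R) (K : nat -> R -> R)
    (n : nat) (a : nat -> R) (g : nat -> R -> R) :
  (forall k, (k < n)%N -> approximable D K (g k)) ->
  approximable D K (fun t => \sum_(k < n) a k * g k t).
Proof.
elim: n => [|n IHn] apg.
  by under eq_fun do rewrite big_ord0; exact: approximable0.
under eq_fun do rewrite big_ord_recr /= addrC.
apply: approximable_linear; first exact: apg.
by apply: IHn => k ltkn; apply/apg/ltnW.
Qed.

Lemma approximable_limit (R : realType) (D : set R) (K : nat -> R -> R)
    (g : R -> R) :
  (forall eps, 0 < eps -> exists2 h, approximable D K h &
     forall t, D t -> `|g t - h t| <= eps) -> approximable D K g.
Proof.
move=> limg eps eps0; have eps2 : 0 < eps / 2 by rewrite divr_gt0.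
have [h aph gh] := limg _ eps2; have [N [c hc]] := aph _ eps2.
exists N, c => t Dt; rewrite (splitr eps) -(subrKA (h t)).
by rewrite (le_trans (ler_normD _ _))// lerD ?gh ?hc.
Qed.

(** * Expansion of the kernel at infinity *)

(** The coefficients of [1 / ((1 - t s) ^ 2 + alpha ^ 2 s ^ 2)] as a power
    series in [s], as polynomials in [t]: Chebyshev polynomials of the second
    kind, rescaled by the modulus of [t + i alpha]. *)
Fixpoint kernel_poly (R : comNzRingType) (alpha : R) (n : nat) : {poly R} :=
  if n is m.+1 then
    if m is l.+1 then
      kernel_poly alpha m * 'X *+ 2
      - (kernel_poly alpha l * 'X * 'X + alpha ^+ 2 *: kernel_poly alpha l)
    else 'X *+ 2
  else 1.

Lemma horner_kernel_polySS (R : comNzRingType) (alpha t : R) n :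
  (kernel_poly alpha n.+2).[t] =
  2 * t * (kernel_poly alpha n.+1).[t]
  - (t ^+ 2 + alpha ^+ 2) * (kernel_poly alpha n).[t].
Proof.
rewrite [kernel_poly alpha n.+2]/= -/(kernel_poly alpha n.+1).
by rewrite !hornerE; ring.
Qed.

(** The degree is exactly [n], over a field of characteristic zero; this is why
    the expansion coefficients span all polynomials. *)
Lemma coef_kernel_poly (R : comNzRingType) (alpha : R) n :
  (kernel_poly alpha n)`_n = n.+1%:R /\
  forall i, (n < i)%N -> (kernel_poly alpha n)`_i = 0.
Proof.
(* The recurrence has two steps, so two consecutive indices are carried. *)
suff [] : ((kernel_poly alpha n)`_n = n.+1%:R /\
    forall i, (n < i)%N -> (kernel_poly alpha n)`_i = 0) /\
  ((kernel_poly alpha n.+1)`_n.+1 = n.+2%:R /\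
    forall i, (n.+1 < i)%N -> (kernel_poly alpha n.+1)`_i = 0) by [].
elim: n => [|n [[topn gtn] [topn1 gtn1]]].
  split; split; rewrite ?coefE//=.
    by case=> // i _; rewrite coefE.
  by case=> [|[|i]]// _; rewrite !coefE mul0rn.
split=> //; rewrite [kernel_poly alpha n.+2]/= -/(kernel_poly alpha n.+1).
split=> [|[|[|i]]// ltni].
  by rewrite !coefE /= topn1 topn gtn//; rewrite -!natr1; ring.
by rewrite !coefE /= gtn1// gtn// gtn ?mulr0 ?addr0 ?subr0 ?mul0rn// 2?ltnW.
Qed.

(** The truncated expansion multiplied by the denominator telescopes, because
    the recurrence of [kernel_poly] is multiplication by
    [1 - 2 t s + (t ^ 2 + alpha ^ 2) s ^ 2]. *)
Lemma kernel_poly_generating (R : comNzRingType) (alpha s t : R) n :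
  ((1 - t * s) ^+ 2 + alpha ^+ 2 * s ^+ 2) *
    \sum_(k < n.+1) s ^+ k * (kernel_poly alpha k).[t] =
  1 - s ^+ n.+1 * ((kernel_poly alpha n.+1).[t]
                   - s * (t ^+ 2 + alpha ^+ 2) * (kernel_poly alpha n).[t]).
Proof.
elim: n => [|n IHn].
  have -> : (kernel_poly alpha 1).[t] = 2 * t by rewrite hornerMn hornerX; ring.
  by rewrite big_ord1 hornerC; ring.
by rewrite big_ord_recr mulrDr IHn horner_kernel_polySS !exprS; ring.
Qed.

Lemma kernel_remainder (F : fieldType) (alpha s t : F) n
    (q := (1 - t * s) ^+ 2 + alpha ^+ 2 * s ^+ 2) : s != 0 -> q != 0 ->
  s ^- n * (q^-1 - \sum_(k < n) s ^+ k * (kernel_poly alpha k).[t]) =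
  (kernel_poly alpha n).[t] +
  s * (((kernel_poly alpha n.+1).[t]
        - s * ((t ^+ 2 + alpha ^+ 2) * (kernel_poly alpha n).[t])) / q).
Proof.
move=> s0 q0; have := kernel_poly_generating alpha s t n.
rewrite -/q big_ord_recr /= mulrDr => /(canRL (addrK _)) gen.
have -> : \sum_(k < n) s ^+ k * (kernel_poly alpha k).[t] =
    q^-1 * (q * \sum_(k < n) s ^+ k * (kernel_poly alpha k).[t]).
  by rewrite mulKf.
rewrite gen exprS; field; apply/andP; split=> //.
by rewrite expf_neq0.
Qed.

(** One constant [M] serves both to keep [s] small enough for the denominator
    to stay away from [0] and to bound the remainder. *)
Lemma kernel_remainder_bound (R : realFieldType) (alpha a b : R) n :
  exists2 M, 0 < M & forall s t, 0 < s -> s * M <= 1 -> a <= t <= b ->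
  let q := (1 - t * s) ^+ 2 + alpha ^+ 2 * s ^+ 2 in
  q != 0 /\
  `|(kernel_poly alpha n).[t]
    - s ^- n * (q^-1 - \sum_(k < n) s ^+ k * (kernel_poly alpha k).[t])|
  <= s * M.
Proof.
have [A Abound] := poly_itv_bound (kernel_poly alpha n.+1) a b.
have [B Bbound] :=
  poly_itv_bound (('X ^+ 2 + (alpha ^+ 2)%:P) * kernel_poly alpha n) a b.
have [T Tbound] := poly_itv_bound 'X a b.
have A0 := normr_ge0 A; have B0 := normr_ge0 B; have T0 := normr_ge0 T.
(* The terms 1 and 2 |T| give s <= 1 and t s <= 1/2, so that q >= 1/4; the
   last one is the bound of the numerator divided by 1/4. *)
exists (1 + 2 * `|T| + 4 * (`|A| + `|B|)) => [|s t s0 sM tab q]; first by lra.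
have sA : 0 <= s * `|A| by rewrite mulr_ge0// ltW.
have sB : 0 <= s * `|B| by rewrite mulr_ge0// ltW.
have sT : 0 <= s * `|T| by rewrite mulr_ge0// ltW.
have s1 : s <= 1 by lra.
have ts : t * s <= 2^-1.
  have tT : t <= `|T|.
    have := Tbound _ tab; rewrite hornerX.
    by have := ler_norm t; have := ler_norm T; lra.
  have : t * s <= `|T| * s by rewrite ler_pM2r.
  by rewrite [`|T| * s]mulrC; lra.
have qge : 4^-1 <= q.
  by have : 0 <= (alpha * s) ^+ 2 by [rewrite sqr_ge0]; rewrite /q; nra.
have q0 : 0 < q by apply: lt_le_trans qge; rewrite invr_gt0.
split; first by rewrite gt_eqF.
rewrite kernel_remainder ?gt_eqF// -/q opprD addNKr normrN.
rewrite normrM (gtr0_norm s0) ler_pM2l// normrM normfV (gtr0_norm q0).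
set r := _ - _.
have rAB : `|r| <= `|A| + `|B|.
  rewrite /r (le_trans (ler_normB _ _))// lerD//.
    by rewrite (le_trans (Abound _ tab))// ler_norm.
  have Bt : `|(t ^+ 2 + alpha ^+ 2) * (kernel_poly alpha n).[t]| <= `|B|.
    apply: le_trans (ler_norm B); apply: le_trans (Bbound _ tab).
    by rewrite hornerM hornerD hornerXn hornerC.
  by rewrite normrM (gtr0_norm s0) -[leRHS]mul1r ler_pM// ltW.
have qV : q^-1 <= 4 by rewrite invf_ple ?posrE.
apply: (@le_trans _ _ ((`|A| + `|B|) * 4)); last by lra.
by rewrite ler_pM// invr_ge0 ltW.
Qed.

(** * Density *)

(** With [s = 1 / y j], the kernel centred at [y j] is [s ^ 2] times the
    expanded function.  Once the coefficients of index below [n] are known to be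
    limits of combinations of kernels, subtracting them and dividing by [s ^ n]
    isolates the coefficient of index [n] as [s] tends to [0]. *)
Lemma approximable_kernel_poly (R : realType) (alpha a b : R) (y : nat -> R) :
  y @ \oo --> +oo -> forall n,
  approximable `[a, b] (fun j t => (alpha ^+ 2 + (t - y j) ^+ 2)^-1)
    (fun t => (kernel_poly alpha n).[t]).
Proof.
move=> /cvgryPge ylim.
pose K j t : R := (alpha ^+ 2 + (t - y j) ^+ 2)^-1; rewrite -/K.
elim/ltn_ind => n IHn; apply: approximable_limit => eps eps0.
have [M M0 Mbound] := kernel_remainder_bound alpha a b n.
have [j [j1 [yM yMeps]]] : exists j, (0 < j)%N /\ M <= y j /\ M / eps <= y j.
  apply: (@filter_ex _ \oo).
  apply: filterS3 (nbhs_infty_gt 0) (ylim M) (ylim (M / eps)).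
  by move=> j.
have y0 : 0 < y j by exact: lt_le_trans yM.
pose s := (y j)^-1.
have s0 : 0 < s by rewrite invr_gt0.
have sM : s * M <= 1 by rewrite mulrC ler_pdivrMr// mul1r.
have sMeps : s * M <= eps by rewrite mulrC ler_pdivrMr// mulrC -ler_pdivrMr.
exists (fun t => s ^- n * s ^- 2 * K j t +
    \sum_(k < n) (- s ^- n * s ^+ k) * (kernel_poly alpha k).[t]).
  apply: (@approximable_linear _ _ K _ (K j)).
    exact: approximable_generator.
  exact: (@approximable_sum _ _ K n (fun k => - s ^- n * s ^+ k)
    (fun k t => (kernel_poly alpha k).[t]) IHn).
move=> t; rewrite /= in_itv /= => tab.
have [q0 remainder] := Mbound s t s0 sM tab.
apply: le_trans sMeps; apply: le_trans remainder.
rewrite le_eqVlt; apply/predU1P; left; congr (`|_ - _|).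
rewrite mulrBr -mulNr big_distrr /= -mulrA; congr (_ * _ + _); last first.
  by apply: eq_bigr => k _; rewrite mulrA.
have -> : K j t = (alpha ^+ 2 + (t - s^-1) ^+ 2)^-1 by rewrite invrK.
have sN0 : s != 0 by rewrite gt_eqF.
rewrite -invfM; congr (_^-1); field; exact: sN0.
Qed.

(** Induction on the degree, cancelling the leading term with a multiple of
    [kernel_poly alpha n], whose leading coefficient [n + 1] is invertible. *)
Lemma approximable_poly (R : realType) (alpha a b : R) (y : nat -> R) :
  y @ \oo --> +oo -> forall p : {poly R},
  approximable `[a, b] (fun j t => (alpha ^+ 2 + (t - y j) ^+ 2)^-1)
    (fun t => p.[t]).
Proof.
move=> ylim p; move: {2}(size p) (leqnn (size p)) => n.
elim: n p => [|n IHn] p.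
  rewrite leqn0 size_poly_eq0 => /eqP->.
  have -> : (fun t => (0 : {poly R}).[t]) = (fun=> 0).
    by apply/funext => t; rewrite horner0.
  exact: approximable0.
move=> /leq_sizeP sizep.
pose l := p`_n / n.+1%:R.
have -> : (fun t => p.[t]) = (fun t => l * (kernel_poly alpha n).[t] +
                            (p - l *: kernel_poly alpha n).[t]).
  by apply/funext => t; rewrite hornerD hornerN hornerZ addrC subrK.
apply: approximable_linear; first exact: approximable_kernel_poly.
apply/IHn/leq_sizeP => i; rewrite leq_eqVlt => /predU1P[<-|ltni].
  by rewrite !coefE (coef_kernel_poly alpha n).1 divfK ?subrr// pnatr_eq0.
by rewrite !coefE (coef_kernel_poly alpha n).2// sizep// mulr0 subr0.
Qed.

Theorem theorem1 (R : realType) (alpha : R) (halpha : alpha != 0)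
    (a b : R) (hab : a < b) (x : int -> R) (hx : scattered x)
    (eps : R) (heps : 0 < eps)
    (f : R -> R) (hf : {within `[a, b], continuous f}) :
  exists (N : nat) (c : nat -> R), (1 <= N)%N /\
    (ereal_sup [set (`|f t - \sum_(1 <= j < N.+1)
                          c j / (alpha ^+ 2 + (t - x j%:Z) ^+ 2)|)%:E
               | t in `[a, b]] < eps%:E)%E.
Proof.
have eps4 : 0 < eps / 4 by rewrite divr_gt0.
have [p fp] := weierstrass_approximation hab hf eps4.
have [_ xlim _] := hx.
have [N [c pc]] := @approximable_poly _ alpha a b _ xlim p _ eps4.
(* A zero coefficient is appended, because [N] may be [0]. *)
exists N.+1, (fun j => if (j < N.+1)%N then c j else 0); split=> //.
apply: (@le_lt_trans _ _ (eps / 2)%:E); last by rewrite lte_fin; lra.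
apply: ge_ereal_sup => _ [t tab <-]; rewrite lee_fin.
have := pc t tab.
rewrite (widen_combination (fun j t => (alpha ^+ 2 + (t - x j%:Z) ^+ 2)^-1)
  c t (leqnSn N)) => {}pc.
have -> : eps / 2 = eps / 4 + eps / 4 by field.
by rewrite -(subrKA p.[t]) (le_trans (ler_normD _ _))// lerD// fp.
Qed.
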